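(* Let $K\subset\mathbb{R}^2$ be a triangle with side lengths $0<x\le y\le z$. Then $$\alpha_1(K)=\min\left\{\frac{z}{y},\ \frac{y}{x},\ 1+\frac{y^2-x^2}{z^2}\right\}.$$ In particular, $\alpha_1(K)=R(K,\Phi_U(K))$ for some one-dimensional linear subspace $U\subset\mathbb{R}^2$ that is parallel to the bisector of the smallest or the largest interior angle of $K$ or perpendicular to the longest edge of $K$.
   Context: Triangles are non-degenerate. The bisector of an interior angle of a triangle is the one that meets the interior of the triangle. For an affine subspace $U\subset\mathbb{R}^2$, $P_U$ is the orthogonal projection onto $U$ and $\Phi_U(x)=2P_U(x)-x$ is the reflection across $U$. For convex bodies (compact convex sets with nonempty interior) $K,C\subset\mathbb{R}^2$, $R(K,C)=\inf\{\lambda>0 : K\subset z+\lambda C\text{ for some }z\in\mathbb{R}^2\}$. The first Minkowski chirality is $\alpha_1(K)=\inf\{R(K,\Phi_U(K)) : U\subset\mathbb{R}^2\text{ affine subspace},\ \dim U=1\}$. *)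

(* Defs.v *)
From HB Require Import structures.
From mathcomp Require Import all_boot all_order all_algebra.
From mathcomp Require Import all_classical all_reals all_analysis.

Set Implicit Arguments.
Unset Strict Implicit.
Unset Printing Implicit Defensive.

Import Order.TTheory GRing.Theory Num.Theory.
Import numFieldNormedType.Exports.
Local Open Scope classical_set_scope.
Local Open Scope ring_scope.

Section Euclidean.
Context {R : realType} {n : nat}.
Implicit Types (u w x : 'rV[R]_n) (U K C : set 'rV[R]_n) (V : {vspace 'rV[R]_n}).

Definition dot u w : R := \sum_(i < n) u 0 i * w 0 i.

(* The canonical norm `|u| on row vectors is the sup norm. *)
Definition enorm u : R := Num.sqrt (dot u u).

Definition angle u w : R := acos (dot u w / (enorm u * enorm w)).

Definition translate x V : set 'rV[R]_n := [set x + u | u in [set` V]].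

Definition affine_subspace (k : nat) U : Prop :=
  exists x V, \dim V = k /\ U = translate x V.

Definition orthoproj U x : 'rV[R]_n :=
  xget 0 [set p | U p /\ forall q, U q -> dot (x - p) (q - p) = 0].

Definition reflection U x : 'rV[R]_n := 2 *: orthoproj U x - x.

(* R(K, C); meant for convex bodies, where the set below is nonempty. *)
Definition circumradius K C : R :=
  inf [set lambda : R | 0 < lambda /\
        exists t, K `<=` [set t + lambda *: c | c in C]].

(* The first Minkowski chirality. *)
Definition alpha1 K : R :=
  inf [set circumradius K (reflection U @` K) | U in affine_subspace 1].

Definition convex_hull : set 'rV[R]_n -> set 'rV[R]_n :=
  smallest (@convex_set R 'rV[R]_n).

End Euclidean.

Section Triangle.
Context {R : realType}.

(* The arithmetic on the vertex indices 'I_3 is modulo 3. *)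
Implicit Types (v : 'I_3 -> 'rV[R]_2) (i : 'I_3).

Definition nondegenerate_triangle v : Prop :=
  free [:: v 1 - v 0; v 2 - v 0].

Definition triangle v : set 'rV[R]_2 := convex_hull (range v).

(* The edge opposite to v i. *)
Definition edge v i : 'rV[R]_2 := v (i + 2) - v (i + 1).

Definition side_length v i : R := enorm (edge v i).

Definition interior_angle v i : R := angle (v (i + 1) - v i) (v (i + 2) - v i).

(* L is the line through v i that makes equal angles with both edges at v i
   and meets the interior of the triangle. *)
Definition interior_bisector v i (L : set 'rV[R]_2) : Prop :=
  [/\ affine_subspace 1 L, L (v i) &
      exists p, [/\ L p, interior (triangle v) p &
        angle (p - v i) (v (i + 1) - v i) = angle (p - v i) (v (i + 2) - v i)]].

Definition parallel (V : {vspace 'rV[R]_2}) (L : set 'rV[R]_2) : Prop :=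
  exists x, L = translate x V.

Definition perpendicular (V : {vspace 'rV[R]_2}) (w : 'rV[R]_2) : Prop :=
  forall u, u \in V -> dot u w = 0.

Definition smallest_angle v i : Prop :=
  forall j, interior_angle v i <= interior_angle v j.

Definition largest_angle v i : Prop :=
  forall j, interior_angle v j <= interior_angle v i.

Definition longest_edge v i : Prop :=
  forall j, side_length v j <= side_length v i.

End Triangle.

(* Main.v *)
(**
Up to translation the reflected triangle is C = S K, where S is the linear
reflection with matrix ((c, s), (s, -c)), c^2 + s^2 = 1.  Expressing
K `<=` t + lambda C in the barycentric coordinates of C shows that R(K, C) is
a sum of three maxima, over the vertices of K, of functions linear in (c, s).
A maximum of linear functions cannot have a positive minimum over the unit
circle at a point where it is linear.  So at a minimum one of the three maxima
is attained at two vertices, which means that S maps an edge of K to a negative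
multiple of an edge of K.  If these edges are distinct, of lengths a and b, then
S is the reflection in the direction of the bisector of the angle between them,
and R(K, C) = max(a/b, b/a); if they coincide, then S is the reflection in the
direction of an altitude, and R(K, C) = 1 + |a^2 - b^2| / c^2, where c is the
length of that edge.  It remains to compare these six values.
*)

Require Import Defs.
From HB Require Import structures.
From mathcomp Require Import all_boot all_order all_algebra.
From mathcomp Require Import all_classical all_reals all_analysis.
From mathcomp Require Import ring lra.

Set Implicit Arguments.
Unset Strict Implicit.
Unset Printing Implicit Defensive.

Import Order.TTheory GRing.Theory Num.Theory.
Import numFieldNormedType.Exports.
Local Open Scope classical_set_scope.
Local Open Scope ring_scope.

(** * Reflections of the plane *)

Section Plane.
Context {R : realType}.
Implicit Types (u w x d : 'rV[R]_2) (c s : R).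

Definition det2 u w : R := u 0 0 * w 0 1 - u 0 1 * w 0 0.

(** The pair (c, s) is not confined to the unit circle, so that [mirror] is linear in it; it is a
    reflection once c^2 + s^2 = 1. *)
Definition mirror c s u : 'rV[R]_2 :=
  \row_j (if j == 0 then c * u 0 0 + s * u 0 1 else s * u 0 0 - c * u 0 1).

Lemma row2P u w : u 0 0 = w 0 0 -> u 0 1 = w 0 1 -> u = w.
Proof.
move=> h0 h1; apply/rowP => j.
have [->//|->//] : j = 0 \/ j = 1.
by case: j => [[|[|//]] ?]; [left|right]; apply/val_inj.
Qed.

Lemma dotE u w : dot u w = u 0 0 * w 0 0 + u 0 1 * w 0 1.
Proof.
rewrite /dot !big_ord_recl big_ord0 addr0.
by rewrite (_ : lift ord0 ord0 = 1) //; exact/val_inj.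
Qed.

Lemma mirror0 c s u : mirror c s u 0 0 = c * u 0 0 + s * u 0 1.
Proof. by rewrite mxE. Qed.

Lemma mirror1 c s u : mirror c s u 0 1 = s * u 0 0 - c * u 0 1.
Proof. by rewrite mxE. Qed.

Definition coordE := (dotE, mirror0, mirror1).

Lemma mirrorD c s u w : mirror c s (u + w) = mirror c s u + mirror c s w.
Proof. by apply: row2P; rewrite [RHS]mxE !coordE !mxE; ring. Qed.

Lemma mirrorZ c s a u : mirror c s (a *: u) = a *: mirror c s u.
Proof. by apply: row2P; rewrite [RHS]mxE !coordE !mxE; ring. Qed.

Lemma mirror_zero c s : mirror c s 0 = 0.
Proof. by apply: row2P; rewrite !coordE !mxE; ring. Qed.

Lemma mirrorN c s u : mirror c s (- u) = - mirror c s u.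
Proof. by rewrite -scaleN1r mirrorZ scaleN1r. Qed.

Lemma mirrorB c s u w : mirror c s (u - w) = mirror c s u - mirror c s w.
Proof. by rewrite mirrorD mirrorN. Qed.

Lemma mirrorK c s : c ^+ 2 + s ^+ 2 = 1 -> involutive (mirror c s).
Proof.
move=> cs u; apply: row2P; rewrite !coordE.
  by rewrite -[RHS]mul1r -cs; ring.
by rewrite -[RHS]mul1r -cs; ring.
Qed.

Lemma det2_mirror c s u w : c ^+ 2 + s ^+ 2 = 1 ->
  det2 (mirror c s u) (mirror c s w) = - det2 u w.
Proof. by move=> cs; rewrite -[det2 u w]mul1r -cs /det2 !coordE; ring. Qed.

Lemma dot_mirror c s u w : c ^+ 2 + s ^+ 2 = 1 ->
  dot (mirror c s u) (mirror c s w) = dot u w.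
Proof. by move=> cs; rewrite -[dot u w]mul1r -cs !coordE; ring. Qed.

Lemma det2Dl u u' w : det2 (u + u') w = det2 u w + det2 u' w.
Proof. by rewrite /det2 !mxE; ring. Qed.

Lemma det2Dr u w w' : det2 u (w + w') = det2 u w + det2 u w'.
Proof. by rewrite /det2 !mxE; ring. Qed.

Lemma det2Zl a u w : det2 (a *: u) w = a * det2 u w.
Proof. by rewrite /det2 !mxE; ring. Qed.

Lemma det2Zr a u w : det2 u (a *: w) = a * det2 u w.
Proof. by rewrite /det2 !mxE; ring. Qed.

Lemma det2Nl u w : det2 (- u) w = - det2 u w.
Proof. by rewrite /det2 !mxE; ring. Qed.

Lemma det2Nr u w : det2 u (- w) = - det2 u w.
Proof. by rewrite /det2 !mxE; ring. Qed.

Lemma det2uu u : det2 u u = 0.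
Proof. by rewrite /det2; ring. Qed.

Lemma det2C u w : det2 u w = - det2 w u.
Proof. by rewrite /det2; ring. Qed.

(** Cramer's rule without division: a vector whose determinants with two independent vectors both
    vanish is zero. *)
Lemma cramer2 u w x : det2 w x *: u = det2 u x *: w - det2 u w *: x.
Proof. by apply: row2P; rewrite /det2 !mxE; ring. Qed.

Lemma dot_ge0 u : 0 <= dot u u.
Proof. by rewrite dotE -!expr2 addr_ge0 ?sqr_ge0. Qed.

Lemma dot_gt0 u : u != 0 -> 0 < dot u u.
Proof.
move=> u0; rewrite lt_def dot_ge0 andbT; apply: contraNneq u0.
rewrite dotE -!expr2 => /eqP; rewrite paddr_eq0 ?sqr_ge0 // !sqrf_eq0.
by move=> /andP[/eqP h0 /eqP h1]; apply/eqP/row2P; rewrite mxE.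
Qed.

Lemma enorm_ge0 u : 0 <= enorm u. Proof. exact: sqrtr_ge0. Qed.

Lemma enorm_gt0 u : u != 0 -> 0 < enorm u.
Proof. by move=> /dot_gt0; rewrite sqrtr_gt0. Qed.

Lemma sqr_enorm u : enorm u ^+ 2 = dot u u.
Proof. by rewrite sqr_sqrtr ?dot_ge0. Qed.

Lemma sqr_dot_det2 u w : dot u u * dot w w = dot u w ^+ 2 + det2 u w ^+ 2.
Proof. by rewrite /det2 !dotE; ring. Qed.

Lemma free_det2 u w : free [:: u; w] -> det2 u w != 0.
Proof.
rewrite free_cons span_seq1 => /andP[+ fw]; apply: contra => /eqP d0.
have w0 : w != 0 by move: fw; rewrite free_cons span_nil memv0 => /andP[].
(* The witness is the coefficient of the orthogonal projection of u onto the line of w; the error in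
   each coordinate is a multiple of [det2 u w]. *)
apply/vlineP; exists (dot u w / dot w w).
have := lt0r_neq0 (dot_gt0 w0); rewrite dotE => ww.
apply: row2P; rewrite [RHS]mxE !dotE; apply/eqP; rewrite -subr_eq0; apply/eqP.
- transitivity (w 0 1 * det2 u w / (w 0 0 * w 0 0 + w 0 1 * w 0 1)).
    by rewrite /det2; field.
  by rewrite d0 mulr0 mul0r.
- transitivity (- w 0 0 * det2 u w / (w 0 0 * w 0 0 + w 0 1 * w 0 1)).
    by rewrite /det2; field.
  by rewrite d0 mulr0 mul0r.
Qed.

(* The entries of the reflection across the line spanned by d are the cosine
   and the sine of twice the argument of d. *)
Definition cos2arg d : R := (d 0 0 ^+ 2 - d 0 1 ^+ 2) / dot d d.
Definition sin2arg d : R := 2 * d 0 0 * d 0 1 / dot d d.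

Lemma cos2arg_sin2arg d : d != 0 -> cos2arg d ^+ 2 + sin2arg d ^+ 2 = 1.
Proof.
move=> /dot_gt0/lt0r_neq0; rewrite /cos2arg /sin2arg dotE => dd.
by field.
Qed.

Lemma mirror_arg d u : d != 0 ->
  mirror (cos2arg d) (sin2arg d) u = (2 * (dot u d / dot d d)) *: d - u.
Proof.
move=> /dot_gt0/lt0r_neq0; rewrite /cos2arg /sin2arg !dotE => dd.
by apply: row2P; rewrite [RHS]mxE !coordE !mxE; field.
Qed.

Lemma dotC u w : dot u w = dot w u.
Proof. by rewrite !dotE; ring. Qed.

Lemma dotDl u u' w : dot (u + u') w = dot u w + dot u' w.
Proof. by rewrite !dotE !mxE; ring. Qed.

Lemma dotZl a u w : dot (a *: u) w = a * dot u w.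
Proof. by rewrite !dotE !mxE; ring. Qed.

Lemma dotNl u w : dot (- u) w = - dot u w.
Proof. by rewrite !dotE !mxE; ring. Qed.

Lemma dotBl u u' w : dot (u - u') w = dot u w - dot u' w.
Proof. by rewrite dotDl dotNl. Qed.

Lemma dotZr a u w : dot u (a *: w) = a * dot u w.
Proof. by rewrite dotC dotZl dotC. Qed.

Lemma orthoproj_line x d u : d != 0 ->
  orthoproj (translate x <[d]>%VS) u = x + (dot (u - x) d / dot d d) *: d.
Proof.
move=> d0; have dd := lt0r_neq0 (dot_gt0 d0).
have subE a b : x + a *: d - (x + b *: d) = (a - b) *: d.
  by rewrite opprD addrACA subrr add0r scalerBl.
have dotE' a : dot (u - (x + a *: d)) d = dot (u - x) d - a * dot d d.
  by rewrite opprD addrA (dotBl (u - x)) dotZl.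
have memU a : translate x <[d]>%VS (x + a *: d).
  by exists (a *: d) => //=; rewrite memvZ ?memv_line.
apply: xget_unique => /=.
  split=> // _ [_ /vlineP[b ->] <-].
  by rewrite subE dotZr dotE' divfK // subrr mulr0.
(* Uniqueness: testing orthogonality against the point one step d further along the line leaves the
   product with d itself. *)
move=> _ [[_ /vlineP[b ->] <-]] /(_ _ (memU (b + 1))) h; congr (_ + _ *: _).
move: h; rewrite subE addrAC subrr add0r scale1r dotE' => /eqP.
by rewrite subr_eq0 => /eqP ->; rewrite mulfK.
Qed.

(** An affine reflection is its linear part followed by a fixed translation, and [circumradius] does
    not see the translation. *)
Lemma reflection_line x d : d != 0 ->
  reflection (translate x <[d]>%VS) =
  (fun u => (x - mirror (cos2arg d) (sin2arg d) x)
            + mirror (cos2arg d) (sin2arg d) u).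
Proof.
move=> d0; apply/funext => u; rewrite /reflection orthoproj_line //.
rewrite !mirror_arg // dotDl dotNl.
by apply: row2P; rewrite !mxE; field; rewrite (lt0r_neq0 (dot_gt0 d0)).
Qed.

Lemma vline_dim1 (V : {vspace 'rV[R]_2}) : \dim V = 1%N ->
  exists2 d, d != 0 & V = <[d]>%VS.
Proof.
move=> V1; have V0 : V != 0%VS by apply: contra_eqN V1 => /eqP ->; rewrite dimv0.
exists (vpick V); rewrite ?vpick0 //.
by apply/esym/eqP; rewrite eqEdim V1 dim_vline vpick0 V0 -memvE memv_pick.
Qed.

Lemma affine_line x d : d != 0 -> affine_subspace 1 (translate x <[d]>%VS).
Proof. by move=> d0; exists x, <[d]>%VS; rewrite dim_vline d0. Qed.

End Plane.
(** * Barycentric coordinates of a triangle *)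

Section Barycentric.
Context {R : realType}.
Implicit Types (v : 'I_3 -> 'rV[R]_2) (i j k : 'I_3) (p q : 'rV[R]_2).

Lemma ord3_add12 i : i + 1 + 2 = i.
Proof. by apply/val_inj; case: i => [[|[|[|//]]] ?]. Qed.

Lemma ord3_add11 i : i + 1 + 1 = i + 2.
Proof. by apply/val_inj; case: i => [[|[|[|//]]] ?]. Qed.

Lemma ord3_add21 i : i + 2 + 1 = i.
Proof. by apply/val_inj; case: i => [[|[|[|//]]] ?]. Qed.

Lemma ord3_add22 i : i + 2 + 2 = i + 1.
Proof. by apply/val_inj; case: i => [[|[|[|//]]] ?]. Qed.

Definition ord3E := (ord3_add11, ord3_add12, ord3_add21, ord3_add22).

Lemma ord3P i j : [\/ j = i, j = i + 1 | j = i + 2].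
Proof.
have [[m mlt] ->] : exists d, j = i + d by exists (j - i); rewrite addrCA subrr addr0.
case: m mlt => [|[|[|//]]] mlt;
  [apply: Or31; rewrite -[RHS]addr0|apply: Or32|apply: Or33];
  congr (_ + _); exact/val_inj.
Qed.

Lemma forall3 i (P : 'I_3 -> Prop) :
  P i -> P (i + 1) -> P (i + 2) -> forall j, P j.
Proof. by move=> ? ? ? j; case: (ord3P i j) => ->. Qed.

Lemma sum3 (V : nmodType) i (F : 'I_3 -> V) : \sum_j F j = F i + F (i + 1) + F (i + 2).
Proof.
rewrite (reindex_inj (addrI i)) /= !big_ord_recl big_ord0 addr0 !addrA.
have -> : ord0 = 0 :> 'I_3 by exact/val_inj.
have -> : lift ord0 ord0 = 1 :> 'I_3 by exact/val_inj.
have -> : lift ord0 (lift ord0 ord0) = 2 :> 'I_3 by exact/val_inj.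
by rewrite addr0 ord3_add11.
Qed.

Lemma edge1 v i : edge v (i + 1) = v i - v (i + 2).
Proof. by rewrite /edge !ord3E. Qed.

Lemma edge2 v i : edge v (i + 2) = v (i + 1) - v i.
Proof. by rewrite /edge !ord3E. Qed.

(** Twice the signed area; dividing by it makes the formulas below independent of the
    orientation. *)
Definition area2 v : R := det2 (v 1 - v 0) (v 2 - v 0).

Lemma nondegenerate_area2 v : nondegenerate_triangle v -> area2 v != 0.
Proof. exact: free_det2. Qed.

(** The edges sum to zero, so passing to the next pair of consecutive edges preserves the
    determinant. *)
Lemma det2_edge v i : det2 (edge v i) (edge v (i + 1)) = area2 v.
Proof.
have H0 : det2 (edge v 0) (edge v (0 + 1)) = area2 v.
  by rewrite edge1 /edge !add0r /area2 /det2 !mxE; ring.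
have H1 : det2 (edge v (0 + 1)) (edge v (0 + 1 + 1)) = area2 v.
  by rewrite -H0 /edge !ord3E /det2 !mxE; ring.
have H2 : det2 (edge v (0 + 2)) (edge v (0 + 2 + 1)) = area2 v.
  by rewrite -H0 /edge !ord3E /det2 !mxE; ring.
exact: (@forall3 0 (fun i => det2 (edge v i) (edge v (i + 1)) = area2 v)) i.
Qed.

Lemma sum_edge v i : edge v i + edge v (i + 1) + edge v (i + 2) = 0.
Proof. by rewrite edge1 edge2 /edge; apply: row2P; rewrite !mxE; ring. Qed.

Lemma sum_det2_edge v p : \sum_i det2 (edge v i) p = 0.
Proof. by rewrite (sum3 0) -!det2Dl sum_edge /det2 !mxE; ring. Qed.

(** The signed area spanned by p and the edge opposite to [v i], relative to that of the whole
    triangle. *)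
Definition bary v i p : R := det2 (edge v i) (p - v (i + 1)) / area2 v.

Lemma baryE v i p :
  bary v i p = det2 (edge v i) p / area2 v - det2 (edge v i) (v (i + 1)) / area2 v.
Proof. by rewrite /bary det2Dr det2Nr mulrBl. Qed.

Lemma baryD v i p q :
  bary v i (p + q) = det2 (edge v i) p / area2 v + bary v i q.
Proof. by rewrite !baryE det2Dr; ring. Qed.

Lemma bary_vertex v : area2 v != 0 -> forall i j, bary v i (v j) = (i == j)%:R.
Proof.
move=> v0 i; rewrite /bary; apply: (forall3 (i := i)).
- rewrite eqxx -[v i - _]opprB -edge2 det2Nr -det2C.
  by rewrite -{2}(ord3_add21 i) det2_edge divff.
- rewrite subrr /det2 !mxE !mulr0 subrr mul0r.
  by case: i => [[|[|[|//]]] ?].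
- rewrite -/(edge v i) det2uu mul0r.
  by case: i => [[|[|[|//]]] ?].
Qed.

Lemma bary_sum v p : area2 v != 0 -> \sum_i bary v i p = 1.
Proof.
move=> v0; under eq_bigr do rewrite baryE -mulrBl.
rewrite -mulr_suml sumrB sum_det2_edge sub0r.
apply: (mulIf v0); rewrite divfK // mul1r (sum3 0) -(det2_edge v 0).
by rewrite edge2 edge1 /edge !ord3E !add0r /det2 !mxE; ring.
Qed.

Lemma bary_combination v p : area2 v != 0 -> p = \sum_i bary v i p *: v i.
Proof.
move=> v0; move: (v0).
rewrite (sum3 0) /bary /edge !ord3E !add0r /area2 /det2 !mxE => v0'.
by apply: row2P; rewrite !mxE; field.
Qed.

Lemma bary_affine v a b p q : a + b = 1 -> area2 v != 0 -> forall i,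
  bary v i (a *: p + b *: q) = a * bary v i p + b * bary v i q.
Proof.
move=> ab v0 i; rewrite !baryE det2Dr !det2Zr.
by rewrite -[X in _ - X]mul1r -ab; ring.
Qed.

Lemma baryK v i (m : 'I_3 -> R) : area2 v != 0 -> \sum_k m k = 1 ->
  bary v i (\sum_k m k *: v k) = m i.
Proof.
move=> v0 m1; rewrite baryE (sum3 i) !det2Dr !det2Zr.
have h k : det2 (edge v i) (v k) =
    (i == k)%:R * area2 v + det2 (edge v i) (v (i + 1)).
  rewrite -(bary_vertex v0) /bary divfK // -det2Dr.
  by congr det2; rewrite subrK.
have -> : det2 (edge v i) (v i) = area2 v + det2 (edge v i) (v (i + 1)).
  by rewrite h eqxx mul1r.
have -> : det2 (edge v i) (v (i + 2)) = det2 (edge v i) (v (i + 1)).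
  by rewrite h; case: (i) => [[|[|[|//]]] ?]; rewrite mul0r add0r.
move: m1; rewrite (sum3 i) => m1.
by rewrite (_ : m i = 1 - m (i + 1) - m (i + 2)); [field|rewrite -m1; ring].
Qed.

Lemma convex_combination (C : set 'rV[R]_2) a b p q : convex_set C ->
  0 <= a -> 0 <= b -> a + b = 1 -> C p -> C q -> C (a *: p + b *: q).
Proof.
move=> Cc a0 b0 ab Cp Cq.
have a1 : a <= 1 by rewrite -ab lerDl.
have := Cc p q (Itv01 a0 a1); rewrite !inE => /(_ Cp Cq).
by rewrite /conv /= /unstable.onem -ab addrAC subrr add0r.
Qed.

(** The region on the right is convex and contains the vertices, so it contains the hull; conversely
    p is the convex combination of the vertices with weights [bary v i p]. *)
Lemma triangleE v p : area2 v != 0 -> triangle v p <-> forall i, 0 <= bary v i p.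
Proof.
move=> v0; split.
  move: p; apply: smallest_sub => [|_ [j _ <-] i]; last first.
    by rewrite bary_vertex // ler0n.
  move=> p q l; rewrite !inE => hp hq i.
  rewrite /conv /= bary_affine //; last by rewrite /unstable.onem addrCA subrr addr0.
  by rewrite addr_ge0 // mulr_ge0 // unstable.onem_ge0.
move=> hp C [Cc Cv].
have Cvi i : C (v i) by apply: Cv; exists i.
rewrite (bary_combination p v0) (sum3 0).
have := bary_sum p v0; rewrite (sum3 0).
move: (hp 0) (hp (0 + 1)) (hp (0 + 2)).
move: (bary v 0 p) (bary v (0 + 1) p) (bary v (0 + 2) p) => a b c a0 b0 c0 abc.
(* Convexity combines two points at a time; normalizing the first two weights requires a + b to be
   nonzero. *)
have [ab0|ab0] := eqVneq (a + b) 0.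
  have [-> ->] : a = 0 /\ b = 0 by split; lra.
  rewrite !scale0r !add0r (_ : c = 1) ?scale1r //; lra.
have ab1 : 0 < a + b by rewrite lt_def ab0 addr_ge0.
rewrite (_ : a *: _ + b *: _ =
    (a + b) *: ((a / (a + b)) *: v 0 + (b / (a + b)) *: v (0 + 1))).
  apply: convex_combination => //; first exact: ltW.
  by apply: convex_combination; rewrite ?(divr_ge0, ltW ab1) // -mulrDl divff.
by rewrite scalerDr !scalerA !(mulrC (a + b)) !divfK.
Qed.

Lemma triangle_vertex v i : triangle v (v i).
Proof. by move=> C [_]; apply; exists i. Qed.

End Barycentric.
(** * The circumradius of a triangle relative to its mirror image *)

Section Chi.
Context {R : realType}.
Implicit Types (v : 'I_3 -> 'rV[R]_2) (i j k : 'I_3) (o p q : 'rV[R]_2) (c s : R).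

Definition max3 (F : 'I_3 -> R) : R := Num.max (F 0) (Num.max (F 1) (F 2)).

Lemma max3_ge (F : 'I_3 -> R) k : F k <= max3 F.
Proof.
rewrite /max3; move: k.
by apply: (@forall3 0); rewrite ?add0r !le_max lexx ?orbT.
Qed.

Lemma max3_le (F : 'I_3 -> R) b : (forall k, F k <= b) -> max3 F <= b.
Proof. by move=> Fb; rewrite /max3 !ge_max !Fb. Qed.

Lemma max3_ex (F : 'I_3 -> R) : exists k, max3 F = F k.
Proof.
rewrite /max3; case: (leP (F 1) (F 2)) => _; case: leP => _;
  by [exists 0|exists 1|exists 2].
Qed.

(** The mirror is an involution, so coordinates in the mirrored triangle are coordinates of the
    mirrored point in the original one. This is the negated linear part of the i-th coordinate of
    [v k]; below, row i means the values for fixed i. *)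
Definition excess v c s i k : R :=
  - det2 (edge v i) (mirror c s (v k)) / area2 v.

(* In the barycentric coordinates of the mirrored triangle C, a containment
   K `<=` t + lambda C bounds each of the three maxima by a number depending on
   t, and the only constraint on these numbers is that their sum is lambda. *)
Definition chi v c s : R := \sum_i max3 (excess v c s i).

(* Moving the origin to o changes the excesses, but not their sum over i. *)
Definition excess_from v c s o i k : R :=
  - det2 (edge v i) (mirror c s (v k - o)) / area2 v.

Lemma excess_fromE v c s o i k :
  excess_from v c s o i k =
  excess v c s i k + det2 (edge v i) (mirror c s o) / area2 v.
Proof. by rewrite /excess_from mirrorB det2Dr det2Nr /excess; ring. Qed.

Lemma sum_excess_from v c s o f :
  \sum_i excess_from v c s o i (f i) = \sum_i excess v c s i (f i).
Proof.
under eq_bigr do rewrite excess_fromE.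
rewrite big_split /= -[RHS]addr0; congr (_ + _).
by rewrite -mulr_suml sum_det2_edge mul0r.
Qed.

(** Any choice of one vertex per row bounds [chi] from below, and [chi_le] bounds it from above by
    row bounds; a convenient origin o then makes [chi] computable. *)
Lemma le_chi v c s o f : \sum_i excess_from v c s o i (f i) <= chi v c s.
Proof. by rewrite sum_excess_from; apply: ler_sum => i _; exact: max3_ge. Qed.

Lemma chi_le v c s o (b : 'I_3 -> R) :
  (forall i k, excess_from v c s o i k <= b i) -> chi v c s <= \sum_i b i.
Proof.
move=> h; have [f fE] := choice (fun i => max3_ex (excess v c s i)).
rewrite /chi (eq_bigr _ (fun i _ => fE i)) -(sum_excess_from _ _ _ o).
by apply: ler_sum.
Qed.

Lemma sum_excess v c s k : \sum_i excess v c s i k = 0.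
Proof. by rewrite -mulr_suml sumrN sum_det2_edge oppr0 mul0r. Qed.

(** For fixed k the excesses sum to zero over i, so [chi] is the sum of the nonnegative gaps between
    the row maxima and the values at k. *)
Lemma excess_max v c s : chi v c s <= 0 ->
  forall i k, excess v c s i k = max3 (excess v c s i).
Proof.
move=> chi0 i k.
have ge0 j : 0 <= max3 (excess v c s j) - excess v c s j k by rewrite subr_ge0 max3_ge.
have : \sum_j (max3 (excess v c s j) - excess v c s j k) = 0.
  apply/le_anti; rewrite sumr_ge0 // andbT sumrB sum_excess.
  by rewrite subr0.
move=> /psumr_eq0P => /(_ (fun j _ => ge0 j)) /(_ i isT) /eqP.
by rewrite subr_eq0 => /eqP.
Qed.

(** Otherwise every row is constant, so edge 0 is parallel to the mirror images of two independent
    edges and must vanish. *)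
Lemma chi_gt0 v c s : area2 v != 0 -> c ^+ 2 + s ^+ 2 = 1 -> 0 < chi v c s.
Proof.
move=> v0 cs; rewrite ltNge; apply/negP => /excess_max exc.
have det0 i j : det2 (edge v 0) (mirror c s (v i - v j)) = 0.
  have : excess v c s 0 i = excess v c s 0 j by rewrite !exc.
  rewrite /excess mirrorB det2Dr det2Nr => /(mulIf (invr_neq0 v0))/oppr_inj ->.
  by rewrite subrr.
have := det2_edge v (0 + 1); rewrite -[LHS]opprK -(det2_mirror _ _ cs) => D.
have := cramer2 (edge v 0) (mirror c s (edge v (0 + 1)))
                (mirror c s (edge v (0 + 1 + 1))).
rewrite /edge !det0 !scale0r subrr => /eqP.
rewrite scaler_eq0 -!/(edge _ _) => /orP[] /eqP e0.
  by move: v0; rewrite -D e0 oppr0 eqxx.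
by move: v0; rewrite -(det2_edge v 0) e0 /det2 !mxE !mul0r subrr eqxx.
Qed.

Lemma sub_scaled_mirror v c s w (l : R) : area2 v != 0 -> c ^+ 2 + s ^+ 2 = 1 ->
  0 < l ->
  (exists t, triangle v `<=`
     [set t + l *: q | q in [set w + mirror c s p | p in triangle v]]) <->
  chi v c s <= l.
Proof.
move=> v0 cs l0; have ln0 := lt0r_neq0 l0; split=> [[t sub]|chil].
  (* The constant terms of the barycentric coordinates are their values at the origin, so they sum
     to 1; multiplied by l, they bound the rows of excesses taken from the origin t + l w. *)
  have r1 : \sum_i (- det2 (edge v i) (v (i + 1)) / area2 v) = 1.
    rewrite -(bary_sum 0 v0); apply: eq_bigr => i _.
    by rewrite /bary sub0r det2Nr.
  rewrite -[leRHS]mulr1 -r1 mulr_sumr; apply: (chi_le (o := t + l *: w)) => i k.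
  rewrite /excess_from.
  have [_ [y Ky <-] <-] := sub _ (@triangle_vertex _ v k).
  have := (triangleE y v0).1 Ky i.
  rewrite (_ : _ - _ = l *: mirror c s y); last first.
    by apply: row2P; rewrite !mxE; ring.
  rewrite mirrorZ mirrorK //.
  rewrite baryE det2Zr => /(mulr_ge0 (ltW l0)) h; rewrite -subr_ge0.
  by apply: (le_trans h); rewrite le_eqVlt; apply/orP; left; apply/eqP; ring.
(* The slack l - chi is shared equally, so that the row bounds m sum to l and m / l are the
   barycentric coordinates of a point q, which determines the translation. *)
set m := fun i => max3 (excess v c s i) + (l - chi v c s) / 3.
have m1 : \sum_i m i / l = 1.
  rewrite -mulr_suml; apply: (mulIf ln0); rewrite divfK // mul1r.
  rewrite big_split /= -/(chi v c s) (sum3 0); lra.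
pose q := \sum_i (m i / l) *: v i.
exists (- l *: (w + mirror c s q)) => p /(triangleE _ v0) Kp.
exists (w + mirror c s (l^-1 *: mirror c s p + q)); last first.
  rewrite mirrorD mirrorZ mirrorK // !scalerDr !scalerA divff // scale1r.
  by apply: row2P; rewrite !mxE; ring.
exists (l^-1 *: mirror c s p + q) => //; apply/(triangleE _ v0) => i.
rewrite baryD baryK // det2Zr.
rewrite (_ : _ + _ = (m i - - det2 (edge v i) (mirror c s p) / area2 v) / l);
  last by ring.
rewrite divr_ge0 ?(ltW l0) // subr_ge0.
(* The excess is linear in the point, so at p it is an average of the values at the vertices, hence
   at most the row maximum. *)
have -> : - det2 (edge v i) (mirror c s p) / area2 v =
    \sum_k bary v k p * excess v c s i k.
  rewrite {1}(bary_combination p v0) !(sum3 0) !mirrorD !mirrorZ !det2Dr !det2Zr.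
  by rewrite /excess; ring.
apply: (@le_trans _ _ (\sum_k bary v k p * max3 (excess v c s i))).
  by apply: ler_sum => k _; rewrite ler_wpM2l ?max3_ge.
by rewrite -mulr_suml bary_sum // mul1r lerDl divr_ge0 // subr_ge0.
Qed.

Lemma circumradius_mirror v c s w : area2 v != 0 -> c ^+ 2 + s ^+ 2 = 1 ->
  circumradius (triangle v) [set w + mirror c s p | p in triangle v] = chi v c s.
Proof.
move=> v0 cs; have chi0 := chi_gt0 v0 cs.
rewrite /circumradius; set E := [set l | _].
have EP l : E l <-> chi v c s <= l.
  split=> [[l0 /sub_scaled_mirror->]//|chil].
  by have l0 := lt_le_trans chi0 chil; split=> //; apply/sub_scaled_mirror.
apply/eqP; rewrite eq_le ge_inf /=; last exact/EP.
  by apply: lb_le_inf => [|l /EP]; first by exists (chi v c s); apply/EP.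
by exists (chi v c s) => l /EP.
Qed.

End Chi.
(** * Reflections mapping an edge to a negative multiple of an edge *)

Section ChiValues.
Context {R : realType}.
Implicit Types (v : 'I_3 -> 'rV[R]_2) (i j k : 'I_3) (u w x : 'rV[R]_2) (c s : R).

Lemma edge_neq0 v i : area2 v != 0 -> edge v i != 0.
Proof.
move=> v0; apply: contra_neq v0 => e0.
by rewrite -(det2_edge v i) e0 /det2 !mxE !mul0r subrr.
Qed.

Lemma side_length_gt0 v i : area2 v != 0 -> 0 < side_length v i.
Proof. by move=> v0; apply/enorm_gt0/edge_neq0. Qed.

Lemma det2_eq0_collinear u w : u != 0 -> det2 u w = 0 -> exists a, w = a *: u.
Proof.
move=> /dot_gt0/lt0r_neq0 u0 uw; exists (dot u w / dot u u); apply: (scalerI u0).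
rewrite scalerA mulrC divfK //; apply: row2P; rewrite [LHS]mxE [RHS]mxE;
  apply/eqP; rewrite -subr_eq0; apply/eqP.
- by rewrite -[RHS](mulr0 (- u 0 1)) -uw /det2 !dotE; ring.
- by rewrite -[RHS](mulr0 (u 0 0)) -uw /det2 !dotE; ring.
Qed.

(* If the maximum of excess v c s i is attained at both endpoints of edge j,
   then the reflection maps edge j to a negative multiple of edge i. *)
Lemma mirror_edge v c s i j : area2 v != 0 -> c ^+ 2 + s ^+ 2 = 1 ->
  excess v c s i (j + 1) = excess v c s i (j + 2) ->
  excess v c s i j <= excess v c s i (j + 1) ->
  mirror c s (edge v j) = - (side_length v j / side_length v i) *: edge v i.
Proof.
move=> v0 cs e12 e01.
have ei0 := edge_neq0 i v0.
have : det2 (edge v i) (mirror c s (edge v j)) = 0.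
  apply: (mulIf (invr_neq0 v0)); rewrite mul0r /edge mirrorB det2Dr det2Nr.
  by move/eqP: e12; rewrite -subr_eq0 => /eqP <-; rewrite /excess; ring.
move=> /(det2_eq0_collinear ei0)[a Sj].
(* The third vertex gives the sign: the determinant of [edge v i] with the image of edge j + 2, over
   the area, is nonpositive, and its product with a is 1. *)
have a_lt0 : a < 0.
  have : det2 (edge v i) (mirror c s (edge v (j + 2))) / area2 v <= 0.
    move: e01; rewrite -subr_ge0 edge2 mirrorB det2Dr det2Nr -oppr_ge0.
    by congr (is_true (0 <= _)); rewrite /excess; ring.
  have : a * (det2 (edge v i) (mirror c s (edge v (j + 2))) / area2 v) = 1.
    rewrite mulrA -det2Zl -Sj det2_mirror // -det2C.
    by have := det2_edge v (j + 2); rewrite ord3_add21 => ->; rewrite divff.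
  move: (_ / _) => b ab b0; rewrite ltNge; apply/negP => a0.
  by have := mulr_ge0_le0 a0 b0; rewrite ab ler10.
rewrite Sj; congr (_ *: _).
have ni := side_length_gt0 i v0.
have : (- a * side_length v i) ^+ 2 = side_length v j ^+ 2.
  rewrite exprMn !sqr_enorm -(dot_mirror (edge v j) _ cs) Sj dotZl dotZr.
  by rewrite -/(dot (edge v i) _); ring.
move=> /eqP; rewrite eqrXn2 ?mulr_ge0 ?enorm_ge0 ?oppr_ge0 ?ltW // => /eqP <-.
by rewrite mulfK ?opprK // lt0r_neq0.
Qed.

(** With the origin at the common vertex [v (i + 2)] of the two edges, all excesses are 0, m, 1/m or
    their negatives. Rows i and i + 1 have maximum 0, and row i + 2 has maximum max(m, 1/m). *)
Lemma chi_bisector v c s i (m : R) : area2 v != 0 -> c ^+ 2 + s ^+ 2 = 1 -> 0 < m ->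
  mirror c s (edge v (i + 1)) = - m *: edge v i -> chi v c s = Num.max m m^-1.
Proof.
move=> v0 cs m0 Sj; have mn0 := lt0r_neq0 m0.
have Si : mirror c s (edge v i) = - m^-1 *: edge v (i + 1).
  rewrite -[in RHS](mirrorK cs (edge v (i + 1))) Sj mirrorZ scalerA mulrNN mulVf //.
  by rewrite scale1r.
pose o := v (i + 2).
have Svi : mirror c s (v i - o) = - m *: edge v i by rewrite -edge1.
have Svj : mirror c s (v (i + 1) - o) = m^-1 *: edge v (i + 1).
  by rewrite -opprB mirrorN -/(edge v i) Si scaleNr opprK.
have Svk : mirror c s (v (i + 2) - o) = 0 *: edge v i.
  by rewrite subrr scale0r mirror_zero.
have Dij := det2_edge v i.
have Dji : det2 (edge v (i + 1)) (edge v i) = - area2 v by rewrite det2C Dij.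
have Dki : det2 (edge v (i + 2)) (edge v i) = area2 v.
  by rewrite -{2}(ord3_add21 i) det2_edge.
have Dkj : det2 (edge v (i + 2)) (edge v (i + 1)) = - area2 v.
  by rewrite det2C -ord3_add11 det2_edge.
have Dii : det2 (edge v i) (edge v i) = 0 by rewrite det2uu.
have Djj : det2 (edge v (i + 1)) (edge v (i + 1)) = 0 by rewrite det2uu.
pose E := excess_from v c s o.
have Eii : E i i = 0 by rewrite /E /excess_from Svi det2Zr Dii; ring.
have Eij : E i (i + 1) = - m^-1 by rewrite /E /excess_from Svj det2Zr Dij; field; rewrite mn0.
have Eji : E (i + 1) i = - m by rewrite /E /excess_from Svi det2Zr Dji; field.
have Ejj : E (i + 1) (i + 1) = 0 by rewrite /E /excess_from Svj det2Zr Djj; ring.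
have Eki : E (i + 2) i = m by rewrite /E /excess_from Svi det2Zr Dki; field.
have Ekj : E (i + 2) (i + 1) = m^-1.
  by rewrite /E /excess_from Svj det2Zr Dkj; field; rewrite mn0.
have Enk n : E n (i + 2) = 0 by rewrite /E /excess_from Svk det2Zr; ring.
have [m1 m2] : m <= Num.max m m^-1 /\ m^-1 <= Num.max m m^-1.
  by rewrite !le_max !lexx orbT.
have iN : (i == i + 2) = false /\ (i + 1 == i + 2) = false.
  by case: (i) => [[|[|[|//]]] ?].
have mi0 : 0 < m^-1 by rewrite invr_gt0.
apply/le_anti/andP; split.
  have := @chi_le _ v c s o (fun n => if n == i + 2 then Num.max m m^-1 else 0).
  rewrite (sum3 i) iN.1 iN.2 eqxx !add0r; apply.
  apply: (@forall3 i) => /=; apply: (@forall3 i);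
    rewrite ?iN.1 ?iN.2 ?eqxx -/(E _ _) ?(Eii, Eij, Eji, Ejj, Eki, Ekj, Enk) //; lra.
rewrite ge_max; apply/andP; split.
  have := le_chi v c s o (fun n => if n == i + 2 then i else i + 2).
  by rewrite (sum3 i) -!/(E _ _) iN.1 iN.2 eqxx !Enk Eki !add0r.
have := le_chi v c s o (fun n => if n == i + 2 then i + 1 else i + 2).
by rewrite (sum3 i) -!/(E _ _) iN.1 iN.2 eqxx !Enk Ekj !add0r.
Qed.

(** The hypothesis on u is a linear system for (c, s) with determinant [dot u u], so it determines
    the reflection. *)
Lemma mirror_normal c s u x : u != 0 -> mirror c s u = - u ->
  mirror c s x = x - (2 * dot x u / dot u u) *: u.
Proof.
move=> /dot_gt0/lt0r_neq0; rewrite dotE => u0 Su.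
have := mirror0 c s u; rewrite Su mxE => h0.
have := mirror1 c s u; rewrite Su mxE => h1.
have cE : c = (u 0 1 * u 0 1 - u 0 0 * u 0 0) / (u 0 0 * u 0 0 + u 0 1 * u 0 1).
  apply: (mulIf u0); rewrite divfK //.
  by transitivity (u 0 0 * (c * u 0 0 + s * u 0 1) - u 0 1 * (s * u 0 0 - c * u 0 1));
    [ring|rewrite -h0 -h1; ring].
have sE : s = (- 2 * u 0 0 * u 0 1) / (u 0 0 * u 0 0 + u 0 1 * u 0 1).
  apply: (mulIf u0); rewrite divfK //.
  by transitivity (u 0 1 * (c * u 0 0 + s * u 0 1) + u 0 0 * (s * u 0 0 - c * u 0 1));
    [ring|rewrite -h0 -h1; ring].
by apply: row2P; rewrite !coordE !mxE cE sE; field.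
Qed.

(** With the origin at [v (i + 1)] the row maxima are 0, max(0, 1 - r) and max(1, r), whose sum is 1
    + |1 - r|; [mirror_normal] expresses 1 - r in the side lengths. *)
Lemma chi_altitude v c s i : area2 v != 0 -> c ^+ 2 + s ^+ 2 = 1 ->
  mirror c s (edge v i) = - edge v i ->
  chi v c s = 1 + `|side_length v (i + 1) ^+ 2 - side_length v (i + 2) ^+ 2|
                  / side_length v i ^+ 2.
Proof.
move=> v0 cs Si.
have ej : edge v (i + 1) = - (edge v i + edge v (i + 2)).
  by rewrite edge1 edge2 /edge; apply: row2P; rewrite !mxE; ring.
have Dki : det2 (edge v (i + 2)) (edge v i) = area2 v.
  by rewrite -{2}(ord3_add21 i) det2_edge.
pose r := det2 (edge v (i + 2)) (mirror c s (edge v (i + 2))) / area2 v.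
have rE : 1 - r = (side_length v (i + 1) ^+ 2 - side_length v (i + 2) ^+ 2)
                  / side_length v i ^+ 2.
  have := dot_gt0 (edge_neq0 i v0); rewrite /r (mirror_normal _ _ Si) ?edge_neq0 //.
  move=> /lt0r_neq0 ei; rewrite det2Dr det2Nr det2uu add0r det2Zr Dki mulNr mulfK //.
  by rewrite !sqr_enorm ej; move: ei; rewrite !dotE !mxE => ei; field.
have -> : `|side_length v (i + 1) ^+ 2 - side_length v (i + 2) ^+ 2| / side_length v i ^+ 2
   = `|1 - r| by rewrite rE normrM normfV (ger0_norm (sqr_ge0 (side_length v i))).
pose o := v (i + 1).
have Svi : mirror c s (v i - o) = - mirror c s (edge v (i + 2)).
  by rewrite -mirrorN edge2 opprB.
have Svj : mirror c s (v (i + 1) - o) = 0 *: edge v i.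
  by rewrite subrr scale0r mirror_zero.
have Svk : mirror c s (v (i + 2) - o) = - edge v i by rewrite -Si.
have Dij := det2_edge v i.
have Dji : det2 (edge v (i + 1)) (edge v i) = - area2 v by rewrite det2C Dij.
have DiSk : det2 (edge v i) (mirror c s (edge v (i + 2))) = - area2 v.
  by rewrite -[edge v i]opprK -Si det2Nl det2_mirror // opprK det2C Dki.
pose E := excess_from v c s o.
have Eii : E i i = - 1.
  by rewrite /E /excess_from Svi det2Nr opprK DiSk mulNr divff.
have Eji : E (i + 1) i = 1 - r.
  rewrite /E /excess_from Svi det2Nr opprK ej det2Nl det2Dl DiSk.
  by rewrite /r; field.
have Eki : E (i + 2) i = r by rewrite /E /excess_from Svi det2Nr opprK.
have Enj n : E n (i + 1) = 0 by rewrite /E /excess_from Svj det2Zr; ring.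
have Eik : E i (i + 2) = 0 by rewrite /E /excess_from Svk det2Nr opprK det2uu mul0r.
have Ejk : E (i + 1) (i + 2) = -1 by rewrite /E /excess_from Svk det2Nr opprK Dji mulNr divff.
have Ekk : E (i + 2) (i + 2) = 1 by rewrite /E /excess_from Svk det2Nr opprK Dki divff.
have ne : [/\ (i + 1 == i) = false, (i + 2 == i) = false & (i + 2 == i + 1) = false].
  by case: (i) => [[|[|[|//]]] ?].
case: ne => n1 n2 n3.
(* For either sign of 1 - r, f picks a maximizing vertex in each row. *)
have [f fE] : exists f, 1 + `|1 - r| = \sum_n E n (f n).
  have [r1|r1] := leP r 1.
    exists (fun n => if n == i then i + 1 else if n == i + 1 then i else i + 2).
    rewrite (sum3 i) eqxx n1 eqxx n2 n3 Enj Eji Ekk ger0_norm; lra.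
  exists (fun n => if n == i + 2 then i else i + 1).
  rewrite (sum3 i) eqxx ![_ == i + 2]eq_sym n2 n3 !Enj Eki ltr0_norm; lra.
apply/le_anti/andP; split; last by rewrite fE; exact: le_chi.
have := @chi_le _ v c s o (fun n => if n == i then 0 else
   if n == i + 1 then Num.max 0 (1 - r) else Num.max 1 r).
rewrite (sum3 i) eqxx n1 eqxx n2 n3 => h; apply: le_trans (h _) _; last first.
  have := ler_norm (1 - r); have := ler_norm (- (1 - r)); rewrite normrN.
  by have := normr_ge0 (1 - r); case: (leP 0 (1 - r)); case: (leP 1 r); lra.
apply: (@forall3 i) => /=; apply: (@forall3 i);
   rewrite ?eqxx ?n1 ?eqxx ?n2 ?n3 -/(E _ _) ?(Eii, Eik, Eji, Ejk, Eki, Ekk, Enj)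
     ?le_max //; lra.
Qed.

End ChiValues.
(** * Minimizing over all reflections *)

Section Minimum.
Context {R : realType}.
Implicit Types (v : 'I_3 -> 'rV[R]_2) (i j k : 'I_3) (c s : R).

Lemma excess_linear v c s i k :
  excess v c s i k = c * excess v 1 0 i k + s * excess v 0 1 i k.
Proof. by rewrite /excess /det2 !coordE; ring. Qed.

Lemma circle_angle c s : c ^+ 2 + s ^+ 2 = 1 ->
  exists t, [/\ - pi <= t <= pi, c = cos t & s = sin t].
Proof.
move=> cs; have c1 : -1 <= c <= 1.
  rewrite -ler_norml -[leRHS](normr1 R) -ler_sqr ?nnegrE ?normr_ge0 //.
  by rewrite !real_normK ?num_real // expr1n -cs lerDl sqr_ge0.
have [/andP[a0 api] aK] := acos_def c1.
have sE : sin (acos c) = `|s| by rewrite sin_acos // -cs addrAC subrr add0r sqrtr_sqr.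
have [s0|s0] := leP 0 s.
  exists (acos c); rewrite aK sE ger0_norm // api andbT; split=> //.
  by apply: le_trans a0; rewrite oppr_le0 pi_ge0.
exists (- acos c); rewrite cosN sinN aK sE ltr0_norm // opprK lerN2 api; split=> //.
by apply: (@le_trans _ _ 0); rewrite ?oppr_le0 // pi_ge0.
Qed.

Lemma chi_trig_continuous v : continuous (fun t => chi v (cos t) (sin t)).
Proof.
have ce i k : continuous (fun t : R => excess v (cos t) (sin t) i k).
  under eq_fun do rewrite excess_linear.
  move=> t; apply: cvgD; apply: cvgMl; [exact: continuous_cos|exact: continuous_sin].
have cm i : continuous (fun t : R => max3 (excess v (cos t) (sin t) i)).
  exact: (max_fun_continuous (ce i 0) (max_fun_continuous (ce i 1) (ce i 2))).
rewrite /chi; under eq_fun do rewrite (sum3 0).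
by move=> t; apply: cvgD; [apply: cvgD|]; exact: cm.
Qed.

(** The circle is the image of the compact interval from -pi to pi, on which the extreme value
    theorem applies. *)
Lemma chi_min v : exists c s, c ^+ 2 + s ^+ 2 = 1 /\
  forall c' s', c' ^+ 2 + s' ^+ 2 = 1 -> chi v c s <= chi v c' s'.
Proof.
have pipi : - pi <= pi :> R by rewrite (@le_trans _ _ 0) ?oppr_le0 ?pi_ge0.
have [t _ tmin] := EVT_min pipi (continuous_subspaceT (@chi_trig_continuous v)).
exists (cos t), (sin t); split; first by rewrite cos2Dsin2.
by move=> c s /circle_angle[u [upi -> ->]]; apply: tmin; rewrite in_itv.
Qed.

Lemma near0_affine_gt0 (a b : R) : 0 < a -> \forall t \near (0 : R), 0 < a + t * b.
Proof.
move=> a0; have : (fun t => a + t * b) x @[x --> (0 : R)] --> a + 0 * b.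
  by apply: cvgD; [exact: cvg_cst|apply: cvgMl; exact: cvg_id].
by rewrite mul0r addr0 => /cvgr_gt; exact.
Qed.

(* Otherwise chi coincides with a linear function H near (c, s); moving along
   the tangent by t and -t and rescaling to the circle by 1/sqrt(1 + t^2)
   decreases the average of H. *)
Lemma chi_min_tie v c s : area2 v != 0 -> c ^+ 2 + s ^+ 2 = 1 ->
  (forall c' s', c' ^+ 2 + s' ^+ 2 = 1 -> chi v c s <= chi v c' s') ->
  exists i k k', [/\ k != k', excess v c s i k = excess v c s i k' &
    forall j, excess v c s i j <= excess v c s i k].
Proof.
move=> v0 cs cmin; apply: contrapT => notie.
have [f fE] := choice (fun i => max3_ex (excess v c s i)).
have fmax i k : k != f i -> 0 < excess v c s i (f i) - excess v c s i k.
  move=> kf; rewrite subr_gt0 lt_neqAle -[leRHS]fE max3_ge andbT.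
  apply/eqP => e; apply: notie; exists i, k, (f i); split=> // j.
  by rewrite e -fE max3_ge.
(* At the tangent point (c, s) + t (-s, c), vertex [f i] still beats vertex k in row i; these
   finitely many conditions hold on a common ball around 0. *)
pose P i k (t : R) := k != f i ->
    0 < (excess v c s i (f i) - excess v c s i k) +
        t * (excess v (- s) c i (f i) - excess v (- s) c i k).
have nearP i k : \forall t \near (0 : R), P i k t.
  have [->|/fmax kf] := eqVneq k (f i); first by apply: filterE => t; rewrite /P eqxx.
  have := near0_affine_gt0 (excess v (- s) c i (f i) - excess v (- s) c i k) kf.
  by apply: filterS => t ? _.
have F0 := nbhs_filter (0 : R).
have := filter_forall F0 (fun i => filter_forall F0 (nearP i)).
move=> /nbhs_ballP[e /= e0 eP].
pose t := e / 2; have t0 : 0 < t by rewrite divr_gt0.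
have te : t < e by rewrite /t; lra.
pose r := Num.sqrt (1 + t ^+ 2).
have t2 : 0 < t ^+ 2 by rewrite exprn_gt0.
have r2 : r ^+ 2 = 1 + t ^+ 2 by rewrite sqr_sqrtr //; lra.
have r1 : 1 < r by rewrite -(ltr_pXn2r (n := 2)) ?nnegrE ?sqrtr_ge0 // expr1n r2; lra.
have r0 : 0 < r by lra.
(* The tangent point has norm r; dividing it by r returns to the circle and divides every excess by
   r. *)
have step a : `|a| < e -> r ^+ 2 = 1 + a ^+ 2 ->
    chi v c s * r <= \sum_i excess v c s i (f i) + a * \sum_i excess v (- s) c i (f i).
  move=> ae ra; rewrite -ler_pdivlMr //.
  have {}eP := eP a; rewrite /ball /= sub0r normrN in eP; move/(_ ae) in eP.
  apply: le_trans (cmin ((c - a * s) / r) ((s + a * c) / r) _) _.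
    rewrite !expr_div_n -mulrDl.
    rewrite (_ : _ + _ = (1 + a ^+ 2) * (c ^+ 2 + s ^+ 2)); last by ring.
    by rewrite cs mulr1 -ra divff // expf_neq0 // lt0r_neq0.
  have E i k : excess v ((c - a * s) / r) ((s + a * c) / r) i k =
      (excess v c s i k + a * excess v (- s) c i k) / r.
    rewrite excess_linear (excess_linear v c) (excess_linear v (- s)).
    by field; rewrite lt0r_neq0.
  rewrite mulr_sumr -big_split /= mulr_suml; apply: ler_sum => i _.
  apply: max3_le => k; rewrite E ler_wpM2r ?invr_ge0 ?(ltW r0) //.
  have [->|/eP] := eqVneq k (f i) => //; lra.
have := step t; rewrite gtr0_norm // => /(_ te r2).
have := step (- t); rewrite normrN gtr0_norm // sqrrN => /(_ te r2).
have -> : \sum_i excess v c s i (f i) = chi v c s by apply: eq_bigr => i _; rewrite fE.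
(* Adding the bounds for t and -t gives chi r <= chi, contrary to chi > 0 and r > 1. *)
have := chi_gt0 v0 cs; move: (\sum_i _) => H; nra.
Qed.

Lemma chi_min_critical v : area2 v != 0 -> exists c s i j,
  [/\ c ^+ 2 + s ^+ 2 = 1,
      mirror c s (edge v j) = - (side_length v j / side_length v i) *: edge v i &
      forall c' s', c' ^+ 2 + s' ^+ 2 = 1 -> chi v c s <= chi v c' s'].
Proof.
move=> v0; have [c [s [cs cmin]]] := chi_min v.
have [i [k [k' [kk' ekk' kmax]]]] := chi_min_tie v0 cs cmin.
(* The tied vertices are the endpoints of the edge opposite to the third vertex, which supplies
   j. *)
exists c, s, i; have [k'E|k'E|k'E] := ord3P k k'.
- by rewrite k'E eqxx in kk'.
- exists (k + 2); split=> //; apply: mirror_edge => //; rewrite !ord3E.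
    by rewrite ekk' k'E.
  exact: kmax.
- exists (k + 1); split=> //; apply: mirror_edge => //; rewrite !ord3E.
    by rewrite ekk' k'E.
  by rewrite -k'E -ekk'; exact: kmax.
Qed.

End Minimum.
(** * Angle bisectors and altitudes *)

Section Bisectors.
Context {R : realType}.
Implicit Types (v : 'I_3 -> 'rV[R]_2) (i j k : 'I_3) (x u w d p : 'rV[R]_2).

Lemma circumradius_line v x d : area2 v != 0 -> d != 0 ->
  circumradius (triangle v) (reflection (translate x <[d]>%VS) @` triangle v) =
  chi v (cos2arg d) (sin2arg d).
Proof.
move=> v0 d0; rewrite reflection_line //.
by apply: circumradius_mirror; rewrite ?cos2arg_sin2arg.
Qed.

Lemma translate0 (V : {vspace 'rV[R]_2}) : translate 0 V = [set` V].
Proof.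
apply/seteqP; split=> [_ [u Vu <-]|u Vu]; first by rewrite add0r.
by exists u; rewrite ?add0r.
Qed.

Lemma bary_continuous v i : continuous (bary v i).
Proof.
have -> : bary v i = fun p => (edge v i 0 0 * p 0 1 - edge v i 0 1 * p 0 0) / area2 v
    - det2 (edge v i) (v (i + 1)) / area2 v.
  by apply/funext => p; rewrite baryE.
move=> p; suff : {for p, continuous (fun q : 'rV[R]_2 =>
    (edge v i 0 0 * q 0 1 - edge v i 0 1 * q 0 0) / area2 v
    - det2 (edge v i) (v (i + 1)) / area2 v)} by [].
apply: continuousB; last exact: cst_continuous.
apply: continuousM; last exact: cst_continuous.
by apply: continuousB; apply: continuousM;
  (exact: cst_continuous || exact: coord_continuous).
Qed.

Lemma interior_triangle v p : area2 v != 0 -> (forall i, 0 < bary v i p) ->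
  interior (triangle v) p.
Proof.
move=> v0 p0; rewrite /interior /=.
have nb i : \forall q \near p, 0 < bary v i q.
  exact: (cvgr_gt _ (@bary_continuous v i p) _ (p0 i)).
apply: filterS (filter_forall (nbhs_filter p) nb) => q q0.
by apply/triangleE => // i; exact: ltW.
Qed.

(** The law of cosines at [v i]. *)
Lemma dot_sides v i :
  2 * dot (v (i + 1) - v i) (v (i + 2) - v i) =
  side_length v (i + 2) ^+ 2 + side_length v (i + 1) ^+ 2 - side_length v i ^+ 2.
Proof. by rewrite !sqr_enorm edge1 edge2 /edge !dotE !mxE; ring. Qed.

Lemma enorm_leg1 v i : enorm (v (i + 1) - v i) = side_length v (i + 2).
Proof. by rewrite /side_length edge2. Qed.

Lemma enorm_leg2 v i : enorm (v (i + 2) - v i) = side_length v (i + 1).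
Proof. by rewrite /side_length edge1 /enorm -opprB !dotNl dotC !dotNl opprK. Qed.

(** Strict Cauchy-Schwarz, from Lagrange's identity [sqr_dot_det2]. *)
Lemma dot_lt_enorm u w : det2 u w != 0 -> `|dot u w| < enorm u * enorm w.
Proof.
move=> uw; rewrite -ltr_sqr ?nnegrE ?normr_ge0 ?mulr_ge0 ?enorm_ge0 //.
rewrite real_normK ?num_real // exprMn !sqr_enorm sqr_dot_det2 ltrDl.
by rewrite lt_def sqr_ge0 sqrf_eq0 uw.
Qed.

Lemma det2_legs v i : det2 (v (i + 1) - v i) (v (i + 2) - v i) = area2 v.
Proof.
rewrite -edge2 -[v (i + 2) - v i]opprB -edge1 det2Nr -det2C -ord3_add11.
exact: det2_edge.
Qed.

(** Each leg at [v i] is weighted by the length of the other, so both summands have equal length and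
    the sum is the diagonal of a rhombus. *)
Definition bisector_dir v i : 'rV[R]_2 :=
  side_length v (i + 1) *: (v (i + 1) - v i)
  + side_length v (i + 2) *: (v (i + 2) - v i).

Lemma bisector_dir_neq0 v i : area2 v != 0 -> bisector_dir v i != 0.
Proof.
move=> v0; have : det2 (v (i + 1) - v i) (bisector_dir v i) != 0.
  rewrite /bisector_dir det2Dr !det2Zr det2uu mulr0 add0r det2_legs mulf_neq0 //.
  by rewrite lt0r_neq0 // side_length_gt0.
by apply: contra_neq => ->; rewrite /det2 !mxE; ring.
Qed.

(** The common factor e is b c (1 + cos A), with b, c the legs and A the angle at [v i]; it cancels
    in the mirror formula. *)
Lemma dot_bisector_dir v i : let d := bisector_dir v i in
  let e := side_length v (i + 1) * side_length v (i + 2)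
           + dot (v (i + 1) - v i) (v (i + 2) - v i) in
  [/\ dot d (v (i + 1) - v i) = side_length v (i + 2) * e,
      dot d (v (i + 2) - v i) = side_length v (i + 1) * e &
      dot d d = 2 * (side_length v (i + 1) * side_length v (i + 2)) * e].
Proof.
move=> d e.
have d1 : dot d (v (i + 1) - v i) = side_length v (i + 2) * e.
  rewrite /d /bisector_dir dotDl !dotZl -sqr_enorm enorm_leg1.
  by rewrite [dot _ (v (i + 1) - v i)]dotC /e; ring.
have d2 : dot d (v (i + 2) - v i) = side_length v (i + 1) * e.
  rewrite /d /bisector_dir dotDl !dotZl -[dot (v (i + 2) - v i) _]sqr_enorm.
  by rewrite enorm_leg2 /e; ring.
split=> //; rewrite {1}/d /bisector_dir dotDl !dotZl ![dot _ d]dotC d1 d2; ring.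
Qed.

Lemma interior_bisectorP v i : area2 v != 0 ->
  interior_bisector v i (translate (v i) <[bisector_dir v i]>%VS).
Proof.
move=> v0; have d0 := bisector_dir_neq0 i v0.
have b0 := side_length_gt0 (i + 1) v0; have c0 := side_length_gt0 (i + 2) v0.
split; first exact: affine_line.
  by exists 0; rewrite ?addr0 //= mem0v.
set b := side_length v (i + 1) in b0 *; set c := side_length v (i + 2) in c0 *.
(* This scaling gives the midpoint of the segment of the bisector inside the triangle, with weights
   1/2, b / (2 (b + c)) and c / (2 (b + c)). *)
pose e := (2 * (b + c))^-1; have e0 : 0 < e by rewrite invr_gt0 mulr_gt0 ?addr_gt0.
exists (v i + e *: bisector_dir v i); split.
- by exists (e *: bisector_dir v i) => //=; rewrite memvZ ?memv_line.
- pose m j := if j == i then 1 / 2 else if j == i + 1 then e * b else e * c.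
  have [n1 n2 n3] :
      [/\ (i + 1 == i) = false, (i + 2 == i) = false & (i + 2 == i + 1) = false].
    by case: (i) => [[|[|[|//]]] ?].
  have [mi mj mk] : [/\ m i = 1 / 2, m (i + 1) = e * b & m (i + 2) = e * c].
    by rewrite /m !eqxx n1 n2 n3.
  have m1 : \sum_j m j = 1.
    rewrite (sum3 i) mi mj mk /e; field; rewrite lt0r_neq0 //; lra.
  have -> : v i + e *: bisector_dir v i = \sum_j m j *: v j.
    rewrite (sum3 i) mi mj mk /bisector_dir -/b -/c (_ : 1 / 2 = 1 - e * b - e * c).
      by apply: row2P; rewrite !mxE; ring.
    rewrite /e; field; rewrite lt0r_neq0 //; lra.
  apply: interior_triangle => // j; rewrite baryK //.
  move: j; apply: (@forall3 i); rewrite ?mi ?mj ?mk ?mulr_gt0 //.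
- have [d1 d2 _] := dot_bisector_dir v i.
  rewrite addrAC subrr add0r /angle !dotZl d1 d2 enorm_leg1 enorm_leg2 -/b -/c.
  congr acos; set n := enorm _; set q := _ + _.
  have n0 : n != 0 by rewrite lt0r_neq0 // enorm_gt0 // scaler_eq0 negb_or d0 lt0r_neq0.
  by field; rewrite n0 !lt0r_neq0.
Qed.

(** Edge i + 2 points out of [v i] and edge i + 1 into it, so swapping the two leg directions maps
    one edge to a negative multiple of the other. *)
Lemma chi_bisector_dir v i (d := bisector_dir v i)
    (m := side_length v (i + 2) / side_length v (i + 1)) : area2 v != 0 ->
  chi v (cos2arg d) (sin2arg d) = Num.max m m^-1.
Proof.
move=> v0; have d0 := bisector_dir_neq0 i v0.
have b0 := side_length_gt0 (i + 1) v0; have c0 := side_length_gt0 (i + 2) v0.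
apply: (@chi_bisector _ _ _ _ (i + 1)); rewrite ?cos2arg_sin2arg // ?divr_gt0 //.
rewrite ord3_add11 edge1 edge2 mirror_arg // dotC.
have [d1 _ dd] := dot_bisector_dir v i.
have : dot d d != 0 by rewrite lt0r_neq0 // dot_gt0.
rewrite /d /m d1 dd !mulf_eq0 !negb_or => /andP[_ e0].
set q := (_ + dot _ _) in d1 dd e0 *.
rewrite (_ : 2 * _ = (side_length v (i + 1))^-1); last by field; rewrite e0 !lt0r_neq0.
rewrite /bisector_dir; apply: row2P; rewrite !mxE; field; exact: lt0r_neq0.
Qed.

Lemma altitude_dir v k : area2 v != 0 -> exists d,
  [/\ d != 0, perpendicular <[d]>%VS (edge v k) &
      mirror (cos2arg d) (sin2arg d) (edge v k) = - edge v k].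
Proof.
move=> v0.
pose d : 'rV[R]_2 := \row_j (if j == 0 then - edge v k 0 1 else edge v k 0 0).
have d0 : d != 0.
  rewrite -(inj_eq (@oppr_inj _)) oppr0.
  apply: contraNneq (edge_neq0 k v0) => d0; apply/eqP/row2P; rewrite !mxE.
    by have := congr1 (fun u => - u 0 1) d0; rewrite !mxE /= opprK oppr0.
  by have := congr1 (fun u => u 0 0) d0; rewrite !mxE /= opprK.
have de : dot d (edge v k) = 0 by rewrite dotE ![d _ _]mxE /=; ring.
exists d; split=> //; first by move=> _ /vlineP[a ->]; rewrite dotZl de mulr0.
by rewrite mirror_arg // dotC de mul0r mulr0 scale0r sub0r.
Qed.

Lemma acos_le_inv (a b : R) : -1 <= a <= 1 -> -1 <= b <= 1 ->
  acos a <= acos b -> b <= a.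
Proof.
move=> a1 b1; apply: contraTT; rewrite -!ltNge => ab.
have [/andP[ha0 ha1] ha] := acos_def a1; have [/andP[hb0 hb1] hb] := acos_def b1.
by rewrite -(ltr_cos (R := R)) ?in_itv /= ?ha0 ?hb0 // ha hb.
Qed.

Lemma side_lt_add v i : area2 v != 0 ->
  side_length v i < side_length v (i + 1) + side_length v (i + 2).
Proof.
move=> v0; have b0 := side_length_gt0 (i + 1) v0; have c0 := side_length_gt0 (i + 2) v0.
have := dot_lt_enorm (u := v (i + 1) - v i) (w := v (i + 2) - v i).
rewrite det2_legs enorm_leg1 enorm_leg2 => /(_ v0); rewrite ltr_norml => /andP[lo _].
have := dot_sides v i => ds.
rewrite -(ltr_pXn2r (n := 2)) ?nnegrE ?enorm_ge0 ?addr_ge0 ?ltW //; nra.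
Qed.

Lemma interior_angleE v i :
  interior_angle v i =
  acos ((side_length v (i + 2) ^+ 2 + side_length v (i + 1) ^+ 2 - side_length v i ^+ 2)
        / (2 * (side_length v (i + 2) * side_length v (i + 1)))).
Proof.
rewrite /interior_angle /angle enorm_leg1 enorm_leg2 -dot_sides; congr acos.
by rewrite -mulf_div divff ?mul1r // pnatr_eq0.
Qed.

Lemma cos_angle_itv v i : area2 v != 0 ->
  -1 <= (side_length v (i + 2) ^+ 2 + side_length v (i + 1) ^+ 2 - side_length v i ^+ 2)
        / (2 * (side_length v (i + 2) * side_length v (i + 1))) <= 1.
Proof.
move=> v0; have b0 := side_length_gt0 (i + 1) v0; have c0 := side_length_gt0 (i + 2) v0.
have bc := mulr_gt0 c0 b0.
have := dot_lt_enorm (u := v (i + 1) - v i) (w := v (i + 2) - v i).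
rewrite det2_legs enorm_leg1 enorm_leg2 => /(_ v0); rewrite ltr_norml => /andP[lo hi].
rewrite -dot_sides ler_pdivrMr ?ler_pdivlMr ?mulr_gt0 //; apply/andP; split; lra.
Qed.

(** After clearing denominators, the difference of the cosines has the factor (a - b) ((a + b)^2 -
    c^2), whose second part is positive by the triangle inequality. *)
Lemma cos_rule_le (a b c : R) : 0 < a -> 0 < b -> 0 < c -> c < a + b ->
  (a ^+ 2 + c ^+ 2 - b ^+ 2) / (2 * (a * c)) <=
    (b ^+ 2 + c ^+ 2 - a ^+ 2) / (2 * (b * c)) ->
  a <= b.
Proof.
move=> a0 b0 c0 cab.
rewrite ler_pdivrMr ?mulr_gt0 // mulrAC ler_pdivlMr ?mulr_gt0 // => h.
rewrite leNgt; apply/negP => ba.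
have : 0 < (a - b) * ((a + b) ^+ 2 - c ^+ 2) * c.
  by rewrite !mulr_gt0 ?subr_gt0 // ltr_pXn2r ?nnegrE ?addr_ge0 ?ltW.
nra.
Qed.

(** This converts the smallest and largest angles of the theorem into shortest and longest opposite
    sides. *)
Lemma angle_le_side v i j : area2 v != 0 ->
  interior_angle v i <= interior_angle v j -> side_length v i <= side_length v j.
Proof.
move=> v0; rewrite !interior_angleE => /acos_le_inv.
move=> /(_ (cos_angle_itv i v0) (cos_angle_itv j v0)).
have s0 k := side_length_gt0 k v0; have st k := side_lt_add k v0.
have [->//|->|->] := ord3P i j; rewrite !ord3E => h.
- apply: (@cos_rule_le _ _ (side_length v (i + 2))) => //.
    by have := st (i + 2); rewrite !ord3E.
  rewrite [side_length v (i + 1) ^+ 2 + _]addrC.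
  by rewrite [side_length v (i + 1) * _]mulrC.
- apply: (@cos_rule_le _ _ (side_length v (i + 1))) => //.
    by have := st (i + 1); rewrite !ord3E [side_length v (i + 2) + _]addrC.
  rewrite [side_length v i ^+ 2 + _]addrC.
  by rewrite [side_length v i * _]mulrC.
Qed.

End Bisectors.
(** * The ordered side lengths *)

Section Assembly.
Context {R : realType}.
Implicit Types (v : 'I_3 -> 'rV[R]_2) (i j k : 'I_3).

Lemma perm_eq_pair (T : eqType) (a b y z : T) :
  perm_eq [:: a; b] [:: y; z] -> (a = y /\ b = z) \/ (a = z /\ b = y).
Proof.
move=> h; have := perm_mem h a; rewrite !inE eqxx /= => /esym/orP[] /eqP aE; subst a.
  by move: h; rewrite perm_cons => /perm_small_eq => /(_ isT) [->]; left.
have zy : perm_eq [:: y; z] [:: z; y] by rewrite (perm_catC [:: y] [:: z]).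
move: (perm_trans h zy); rewrite perm_cons => /perm_small_eq => /(_ isT) [->].
by right.
Qed.

Lemma perm_eq_triple (T : eqType) (a b c x y z : T) :
  perm_eq [:: a; b; c] [:: x; y; z] ->
  [\/ a = x /\ perm_eq [:: b; c] [:: y; z],
      a = y /\ perm_eq [:: b; c] [:: x; z] |
      a = z /\ perm_eq [:: b; c] [:: x; y]].
Proof.
move=> h; have := perm_mem h a; rewrite !inE eqxx /= => /esym/or3P[] /eqP aE; subst a.
- by apply: Or31; rewrite perm_cons in h.
- apply: Or32; split=> //; rewrite -(perm_cons y); apply: perm_trans h _.
  by rewrite (perm_catCA [:: x] [:: y] [:: z]).
- apply: Or33; split=> //; rewrite -(perm_cons z); apply: perm_trans h _.
  by rewrite (perm_catC [:: x; y] [:: z]).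
Qed.

Lemma perm_sides v i (s : seq R) : perm_eq [seq side_length v j | j : 'I_3] s ->
  perm_eq [:: side_length v i; side_length v (i + 1); side_length v (i + 2)] s.
Proof.
apply: perm_trans.
rewrite (_ : [:: _; _; _] = [seq side_length v j | j <- [:: i; i + 1; i + 2]]) //.
apply: perm_map; apply: uniq_perm; rewrite ?enum_uniq //.
  by case: i => [[|[|[|//]]] ?].
move=> j; rewrite mem_enum !inE.
by have [->|->|->] := ord3P i j; rewrite eqxx ?orbT.
Qed.

Lemma chi_min_value v : area2 v != 0 -> exists c s k, [/\
  c ^+ 2 + s ^+ 2 = 1,
  forall c' s', c' ^+ 2 + s' ^+ 2 = 1 -> chi v c s <= chi v c' s' &
  chi v c s = Num.max (side_length v (k + 2) / side_length v (k + 1))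
                      (side_length v (k + 1) / side_length v (k + 2)) \/
  chi v c s = 1 + `|side_length v (k + 1) ^+ 2 - side_length v (k + 2) ^+ 2|
                  / side_length v k ^+ 2].
Proof.
move=> v0; have [c [s [i [j [cs Sj cmin]]]]] := chi_min_critical v0.
have pos k := side_length_gt0 k v0.
have [jE|jE|jE] := ord3P i j; rewrite {}jE in Sj.
- exists c, s, i; split=> //; right; apply: chi_altitude => //.
  by rewrite Sj divff ?scaleN1r // lt0r_neq0.
- exists c, s, (i + 2); split=> //; left; rewrite !ord3E.
  by rewrite (chi_bisector v0 cs _ Sj) ?divr_gt0 // invf_div.
(* As the mirror is an involution, the relation can be inverted to the form that [chi_bisector]
   takes at index i + 2. *)
- exists c, s, (i + 1); split=> //; left; rewrite !ord3E.
  have Si : mirror c s (edge v i) =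
      - (side_length v i / side_length v (i + 2)) *: edge v (i + 2).
    rewrite -[edge v (i + 2)](mirrorK cs) Sj mirrorZ scalerA (_ : _ * _ = 1) ?scale1r //.
    by field; rewrite !lt0r_neq0.
  rewrite -{1}(ord3_add21 i) in Si.
  by rewrite (@chi_bisector _ _ _ _ (i + 2) _ v0 cs _ Si) ?ord3E ?divr_gt0 // invf_div.
Qed.

(** With equal sides, side i may be matched with y or z; minimality then forces that value to equal
    x. [perm_sides_max] is symmetric. *)
Lemma perm_sides_min v i (x y z : R) : x <= y -> y <= z ->
  perm_eq [seq side_length v j | j : 'I_3] [:: x; y; z] ->
  (forall j, side_length v i <= side_length v j) ->
  perm_eq [:: side_length v (i + 1); side_length v (i + 2)] [:: y; z].
Proof.
move=> xy yz /(perm_sides i)/perm_eq_triple sides imin.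
have := imin (i + 1); have := imin (i + 2).
case: sides => -[-> h] //; case: (perm_eq_pair h) => -[E1 E2];
  move: h; rewrite E1 E2 => h h1 h2; apply: perm_trans h _.
- by rewrite (_ : x = y) //; lra.
- by rewrite (_ : x = y) //; lra.
- have -> : x = z by lra. by have -> : y = z by lra.
- have -> : x = z by lra. by have -> : y = z by lra.
Qed.

Lemma perm_sides_max v i (x y z : R) : x <= y -> y <= z ->
  perm_eq [seq side_length v j | j : 'I_3] [:: x; y; z] ->
  (forall j, side_length v j <= side_length v i) ->
  side_length v i = z /\
  perm_eq [:: side_length v (i + 1); side_length v (i + 2)] [:: x; y].
Proof.
move=> xy yz /(perm_sides i)/perm_eq_triple sides imax.
have := imax (i + 1); have := imax (i + 2).
case: sides => -[-> h] //; case: (perm_eq_pair h) => -[E1 E2];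
  move: h; rewrite E1 E2 => h h1 h2; split; try lra; apply: perm_trans h _.
- have -> : z = x by lra. by have -> : y = x by lra.
- have -> : z = x by lra. by have -> : y = x by lra.
- by rewrite (_ : z = y) //; lra.
- by rewrite (_ : z = y) //; lra.
Qed.

Definition triangle_chirality (x y z : R) : R :=
  Num.min (z / y) (Num.min (y / x) (1 + (y ^+ 2 - x ^+ 2) / z ^+ 2)).

(** The pairs {y, z} and {x, y} give terms of the minimum, and z / x is at least z / y. *)
Lemma triangle_chirality_le_ratio (x y z b c : R) : 0 < x -> x <= y -> y <= z ->
  perm_eq [:: b; c] [:: y; z] \/ perm_eq [:: b; c] [:: x; z] \/
    perm_eq [:: b; c] [:: x; y] ->
  triangle_chirality x y z <= Num.max (b / c) (c / b).
Proof.
move=> x0 xy yz.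
have y0 : 0 < y by lra. have z0 : 0 < z by lra.
have zx : z / y <= z / x by rewrite ler_pM2l // lef_pV2 // posrE.
rewrite /triangle_chirality !ge_min !le_max.
by case=> [|[]] /perm_eq_pair [] [-> ->]; rewrite ?lexx ?zx ?orbT.
Qed.

(** The altitude on z gives a term of the minimum, the one on y gives at least that term, and the
    one on x gives at least z / y. *)
Lemma triangle_chirality_le_altitude (x y z a b c : R) : 0 < x -> x <= y -> y <= z ->
  [\/ a = x /\ perm_eq [:: b; c] [:: y; z],
      a = y /\ perm_eq [:: b; c] [:: x; z] |
      a = z /\ perm_eq [:: b; c] [:: x; y]] ->
  triangle_chirality x y z <= 1 + `|b ^+ 2 - c ^+ 2| / a ^+ 2.
Proof.
move=> x0 xy yz abc.
have y0 : 0 < y by lra. have z0 : 0 < z by lra.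
have sq (s t : R) : 0 < s -> s <= t -> s ^+ 2 <= t ^+ 2.
  by move=> s0 st; rewrite ler_pXn2r ?nnegrE //; lra.
have norm_sq (s t : R) : 0 < s -> s <= t -> perm_eq [:: b; c] [:: s; t] ->
    `|b ^+ 2 - c ^+ 2| = t ^+ 2 - s ^+ 2.
  move=> s0 st /perm_eq_pair[] [-> ->]; last by rewrite ger0_norm // subr_ge0 sq.
  by rewrite distrC ger0_norm // subr_ge0 sq.
case: abc => -[-> /norm_sq ->] //; try lra; rewrite /triangle_chirality !ge_min.
- apply/orP; left; rewrite -subr_ge0.
  rewrite (_ : _ - _ = (z - y) * (y * z + (y ^+ 2 - x ^+ 2)) / (y * x ^+ 2)); last first.
    by field; rewrite !lt0r_neq0.
  apply: divr_ge0; apply: mulr_ge0; rewrite ?sqr_ge0 //; try lra.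
  by apply: addr_ge0; [apply: mulr_ge0; lra|rewrite subr_ge0 sq].
- apply/orP; right; apply/orP; right; rewrite lerD2l.
  apply: (@le_trans _ _ ((z ^+ 2 - x ^+ 2) / z ^+ 2)).
    by rewrite ler_wpM2r ?invr_ge0 ?sqr_ge0 // lerB // sq.
  rewrite ler_wpM2l ?subr_ge0 ?sq //; first lra.
  by rewrite lef_pV2 ?posrE ?exprn_gt0 // sq.
- by rewrite lexx !orbT.
Qed.

End Assembly.

Theorem proposition6p4 (R : realType) (v : 'I_3 -> 'rV[R]_2) (K : set 'rV[R]_2)
    (x y z : R) (hv : nondegenerate_triangle v) (hK : K = triangle v)
    (hxyz : perm_eq [seq side_length v i | i : 'I_3] [:: x; y; z])
    (hx : 0 < x) (hxy : x <= y) (hyz : y <= z) :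
  alpha1 K =
    Num.min (z / y) (Num.min (y / x) (1 + (y ^+ 2 - x ^+ 2) / z ^+ 2)) /\
  (forall i j k : 'I_3,
     smallest_angle v i -> largest_angle v j -> longest_edge v k ->
     exists V : {vspace 'rV[R]_2},
       [/\ \dim V = 1%N,
           alpha1 K = circumradius K (reflection [set` V] @` K) &
           [\/ exists2 L, interior_bisector v i L & parallel V L,
               exists2 L, interior_bisector v j L & parallel V L |
               perpendicular V (edge v k)]]).
Proof.
rewrite -/(triangle_chirality x y z); set M := triangle_chirality x y z.
have v0 := nondegenerate_area2 hv.
have y0 : 0 < y by lra. have z0 : 0 < z by lra.
have sides i := perm_eq_triple (perm_sides i hxyz).
have lower c s : c ^+ 2 + s ^+ 2 = 1 -> M <= chi v c s.
  move=> cs; have [c0 [s0 [k [_ /(_ _ _ cs) cmin val]]]] := chi_min_value v0.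
  apply: le_trans cmin; case: val => ->.
    rewrite maxC; apply: triangle_chirality_le_ratio => //.
    by have [[_]|[_]|[_]] := sides k; tauto.
  exact: triangle_chirality_le_altitude.
have attained i j k : smallest_angle v i -> largest_angle v j -> longest_edge v k ->
    exists V : {vspace 'rV[R]_2},
     [/\ \dim V = 1%N, circumradius K (reflection [set` V] @` K) = M &
         [\/ exists2 L, interior_bisector v i L & parallel V L,
             exists2 L, interior_bisector v j L & parallel V L |
             perpendicular V (edge v k)]].
  move=> hi hj hk.
  (* By [lower], an upper bound suffices for equality. *)
  have dir d : d != 0 -> chi v (cos2arg d) (sin2arg d) <= M ->
      circumradius K (reflection [set` <[d]>%VS] @` K) = M.
    move=> d0 dM; rewrite hK -translate0 circumradius_line //.
    by apply/le_anti; rewrite dM lower // cos2arg_sin2arg.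
  have pos n := side_length_gt0 n v0.
  have ix := perm_sides_min hxy hyz hxyz (fun n => angle_le_side v0 (hi n)).
  have [_ jz] := perm_sides_max hxy hyz hxyz (fun n => angle_le_side v0 (hj n)).
  have kz := perm_sides_max hxy hyz hxyz hk.
  have dim1 d : d != 0 -> \dim <[d]>%VS = 1%N by move=> d0; rewrite dim_vline d0.
  (* The term attaining the minimum selects the line: z / y the bisector between the sides y and z,
     y / x the one between x and y, and the third term the altitude on z. *)
  have [Mzy|Mnzy] := eqVneq M (z / y).
    have d0 := bisector_dir_neq0 i v0.
    exists <[bisector_dir v i]>%VS; split; [exact: dim1| |apply: Or31].
      apply: dir => //; rewrite chi_bisector_dir // Mzy invf_div.
      have zy : y / z <= z / y by rewrite ler_pdivrMr // mulrAC ler_pdivlMr // ; nra.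
      by case: (perm_eq_pair ix) => -[-> ->]; rewrite ge_max lexx zy.
    exists (translate (v i) <[bisector_dir v i]>%VS); last by exists (v i).
    exact: interior_bisectorP.
  have [Myx|Mnyx] := eqVneq M (y / x).
    have d0 := bisector_dir_neq0 j v0.
    exists <[bisector_dir v j]>%VS; split; [exact: dim1| |apply: Or32].
      apply: dir => //; rewrite chi_bisector_dir // Myx invf_div.
      have yx : x / y <= y / x by rewrite ler_pdivrMr // mulrAC ler_pdivlMr // ; nra.
      by case: (perm_eq_pair jz) => -[-> ->]; rewrite ge_max lexx yx.
    exists (translate (v j) <[bisector_dir v j]>%VS); last by exists (v j).
    exact: interior_bisectorP.
  have ME : M = 1 + (y ^+ 2 - x ^+ 2) / z ^+ 2.
    move: Mnzy Mnyx; rewrite /M /triangle_chirality.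
    by case: leP => [|_]; rewrite ?eqxx //; case: leP; rewrite ?eqxx.
  have [d [d0 dperp Sd]] := altitude_dir k v0.
  exists <[d]>%VS; split; [exact: dim1| |exact: Or33].
  apply: dir => //; rewrite (chi_altitude v0 _ Sd) ?cos2arg_sin2arg //.
  have [-> /perm_eq_pair kxy] := kz.
  have yx2 : 0 <= y ^+ 2 - x ^+ 2 by nra.
  by case: kxy => -[-> ->]; rewrite ME ?[`|x ^+ 2 - _|]distrC ger0_norm.
have alphaE : alpha1 K = M.
  rewrite /alpha1; set E := [set _ | _ in _].
  have lb r : E r -> M <= r.
    case=> _ [x0 [V [/vline_dim1 [d d0 ->] ->]]] <-.
    by rewrite hK circumradius_line // lower // cos2arg_sin2arg.
  have EM : E M.
    (* Extremal indices exist as there are only three, so [attained] applies and the infimum is a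
       minimum. *)
    pose i := [arg min_(i < 0 : 'I_3) interior_angle v i]%O.
    pose j := [arg max_(j > 0 : 'I_3) interior_angle v j]%O.
    pose k := [arg max_(k > 0 : 'I_3) side_length v k]%O.
    have hi : smallest_angle v i.
      by rewrite /i; case: Order.TotalTheory.arg_minP => // ? _ h n; exact: h.
    have hj : largest_angle v j.
      by rewrite /j; case: Order.TotalTheory.arg_maxP => // ? _ h n; exact: h.
    have hk : longest_edge v k.
      by rewrite /k; case: Order.TotalTheory.arg_maxP => // ? _ h n; exact: h.
    have [V [dV cV _]] := attained i j k hi hj hk.
    exists [set` V] => //; exists 0, V; split=> //; exact/esym/translate0.
  apply/le_anti; rewrite ge_inf //=; last by exists M => r /lb.
  by apply: lb_le_inf => [|r /lb //]; exists M.
split=> // i j k hi hj hk; have [V [dV cV alt]] := attained i j k hi hj hk.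
by exists V; rewrite alphaE cV.
Qed.
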